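(* Let $v \ge 2$ and $n \ge 1$ be integers, let $\ell^1, \dots, \ell^n \in \mathbb{R}^v$, and let $p^i = \operatorname{softmax}(\ell^i)$ for $i = 1,\dots,n$. Suppose that for each $i$, $p^i_v$ is the highest and $p^i_{v-1}$ the second highest entry of $p^i$ (i.e. $p^i_v \ge p^i_{v-1} \ge p^i_j$ for all $j \le v-2$). Let $T \subseteq \{1,\dots,v\}$ be a set of tokens with $v \notin T$ and $v-1 \notin T$, let $\beta \in \mathbb{R}$, and for each $i$ let $p^{i\prime} = \operatorname{softmax}(\ell^{i\prime})$, where $\ell^{i\prime}_j = \ell^i_j + \beta$ for $j \in T$ and $\ell^{i\prime}_j = \ell^i_j$ for $j \notin T$. Then for every $i \in \{1,\dots,n\}$, $$\log p^i_v - \log p^i_{v-1} = \log p^{i\prime}_v - \log p^{i\prime}_{v-1}.$$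
   Context: For $x \in \mathbb{R}^v$, $\operatorname{softmax}(x)_i = \exp(x_i) / \sum_{j=1}^v \exp(x_j)$. The distributions $p^1,\dots,p^n$ model the possible outputs of a stochastic language model API (which returns from one of them at random), and $p^{i\prime}$ is the $i$-th output after a logit bias $\beta$ is added to the tokens in $T$. *)

(* Defs.v *)
From mathcomp Require Export all_boot all_order all_algebra.
From mathcomp Require Export reals.
From mathcomp Require Export sequences exp.

Set Implicit Arguments.
Unset Strict Implicit.
Unset Printing Implicit Defensive.

Local Open Scope ring_scope.

Definition softmax (R : realType) (v : nat) (x : 'rV[R]_v) : 'rV[R]_v :=
  \row_i (expR (x 0 i) / \sum_(j < v) expR (x 0 j)).

(* Main.v *)
Require Import Defs.
From mathcomp Require Import all_boot all_order all_algebra.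
From mathcomp Require Import reals.
From mathcomp Require Import sequences exp.

Set Implicit Arguments.
Unset Strict Implicit.
Unset Printing Implicit Defensive.

Import GRing.Theory Num.Theory.

Local Open Scope ring_scope.

(** The log of a softmax entry is its logit minus the log of the normalizer, which is the same for
    all tokens. It cancels in a difference of two log-probabilities, leaving the difference of
    logits ([ln_softmaxB]). The bias changes the normalizer but not the logits outside [T]. *)

Lemma sum_expR_gt0 (R : realType) (v : nat) (x : 'rV[R]_v) (a : 'I_v) :
  0 < \sum_(j < v) expR (x 0 j).
Proof.
(* The index [a] rules out the empty sum ([v = 0]), whose value is 0. *)
rewrite (bigD1 a) //= ltr_wpDr ?expR_gt0 //.
by apply: sumr_ge0 => j _; exact: expR_ge0.
Qed.

Lemma ln_softmax (R : realType) (v : nat) (x : 'rV[R]_v) (a : 'I_v) :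
  ln (softmax x 0 a) = x 0 a - ln (\sum_(j < v) expR (x 0 j)).
Proof.
by rewrite mxE ln_div ?posrE ?expR_gt0 ?(sum_expR_gt0 x a) // expRK.
Qed.

Lemma ln_softmaxB (R : realType) (v : nat) (x : 'rV[R]_v) (a b : 'I_v) :
  ln (softmax x 0 a) - ln (softmax x 0 b) = x 0 a - x 0 b.
Proof. by rewrite !ln_softmax opprB addrA subrK. Qed.

(* Tokens 1, ..., v are the ordinals 0, ..., v - 1 of 'I_v, so that [top] is
   token v and [second] is token v - 1. *)
Theorem mainTheorem5 (R : realType) (v n : nat) (hv : (2 <= v)%N) (hn : (1 <= n)%N)
    (top second : 'I_v)
    (htop : nat_of_ord top = (v - 1)%N) (hsecond : nat_of_ord second = (v - 2)%N)
    (l p : 'I_n -> 'rV[R]_v)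
    (hp : forall i, p i = softmax (l i))
    (hhighest : forall i, p i 0 second <= p i 0 top)
    (hsecond_highest : forall i (j : 'I_v),
        (j < v - 2)%N -> p i 0 j <= p i 0 second)
    (T : {set 'I_v}) (htopT : top \notin T) (hsecondT : second \notin T)
    (beta : R)
    (l' p' : 'I_n -> 'rV[R]_v)
    (hl'_in : forall i (j : 'I_v), j \in T -> l' i 0 j = l i 0 j + beta)
    (hl'_out : forall i (j : 'I_v), j \notin T -> l' i 0 j = l i 0 j)
    (hp' : forall i, p' i = softmax (l' i)) :
  forall i : 'I_n,
    ln (p i 0 top) - ln (p i 0 second) = ln (p' i 0 top) - ln (p' i 0 second).
Proof.
(* Both sides are now logit differences at [top] and [second]; [htopT] and [hsecondT] discharge the
   conditions of [hl'_out]. *)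
by move=> i; rewrite hp hp' !ln_softmaxB !hl'_out.
Qed.
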